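(* Let $N$ be a positive integer, $0<\beta<1/(2N+1)$ and $t>0$. Let $\Gamma\subset\mathbb{R}$ be the unique non-empty compact set with $\Gamma=\bigcup_{i=0}^N\phi_i(\Gamma)$, where $\phi_i(x)=\beta x+i\frac{1-\beta}{N}$. Then $\Gamma\cup(\Gamma+t)$ is a self-similar set if and only if $t=\frac{j(1-\beta)}{N}\beta^{-k}$ for some $j\in\big\{1,2,\ldots,\lfloor\frac{N+1}{2}\rfloor\big\}$ and some positive integer $k$.
   Context: A non-empty compact set $E\subset\mathbb{R}$ is called a self-similar set if there is a finite set of contractive similitudes $f_i(x)=r_ix+b_i$ ($0<|r_i|<1$, $b_i\in\mathbb{R}$, $1\le i\le n$) such that $E=\bigcup_{i=1}^n f_i(E)$. For $X\subset\mathbb{R}$, $b\in\mathbb{R}$, $X+b=\{x+b:x\in X\}$; $\lfloor x\rfloor$ is the integer part of $x$. *)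

(* Defs.v *)
From HB Require Import structures.
From mathcomp Require Import all_boot all_order all_algebra.
From mathcomp Require Import all_classical all_reals all_analysis.

Set Implicit Arguments.
Unset Strict Implicit.
Unset Printing Implicit Defensive.

Import Order.TTheory GRing.Theory Num.Theory.
Import numFieldNormedType.Exports.

Local Open Scope classical_set_scope.
Local Open Scope ring_scope.

Definition similitude (R : realType) (r b : R) : R -> R := fun x => r * x + b.

Definition translate (R : realType) (X : set R) (b : R) : set R :=
  [set x + b | x in X].

(* The similitudes are given as a finite indexed family; repetitions are
   harmless, and n = 0 is excluded because E is non-empty. *)
Definition self_similar (R : realType) (E : set R) : Prop :=
  [/\ E !=set0, compact E &
      exists (n : nat) (r b : 'I_n -> R),
        (forall i, 0 < `|r i| < 1) /\
        E = \bigcup_(i in [set: 'I_n]) (similitude (r i) (b i) @` E)].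

Definition phi (R : realType) (N : nat) (beta : R) (i : 'I_N.+1) : R -> R :=
  similitude beta (i%:R * ((1 - beta) / N%:R)).

(* By Hutchinson's theorem, exactly one set satisfies this predicate when
   0 < N and 0 < beta < 1. *)
Definition is_attractor (R : realType) (N : nat) (beta : R) (Gamma : set R) :
    Prop :=
  [/\ Gamma !=set0, compact Gamma &
      Gamma = \bigcup_(i in [set: 'I_N.+1]) (phi beta i @` Gamma)].

(* Main.v *)
Require Import Defs.
From HB Require Import structures.
From mathcomp Require Import all_boot all_order all_algebra.
From mathcomp Require Import all_classical all_reals all_analysis.
From mathcomp Require Import zify ring lra.

Set Implicit Arguments.
Unset Strict Implicit.
Unset Printing Implicit Defensive.

Import Order.TTheory GRing.Theory Num.Theory.
Import numFieldNormedType.Exports.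

Local Open Scope classical_set_scope.
Local Open Scope ring_scope.

(** Put [d = (1 - beta) / N]. The points of [Gamma] are the sums of
    [x_j * d * beta ^ j] over [j], with digits [x_j] between [0] and [N]; the
    hull of [Gamma] is [0, 1], and [beta < 1 / (2N+1)] amounts to
    [2 * beta < d]. Two consequences of that inequality drive the proof.
    - Expansions with digits in [0, 2N] are unique ([expansion_inj]), so sums
      of two points of [Gamma] and equations [c' - c = s] between finite
      expansions can be read digit by digit.
    - The gaps between neighbouring first-level pieces of [Gamma] have length
      [d - beta > beta]. A copy [r * Gamma + c] inside [Gamma] with [r < 1]
      has gaps too short to straddle one of them, so it lies in a single
      piece; rescaling and repeating, it is a cylinder: [r = beta ^ k] and [c]
      is a sum of [k] digits ([attractor_embed]).

    Write [E] for the union of [Gamma] and [Gamma + t]. It is symmetric about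
    its centre, so the similitudes generating it may be taken increasing.

    _Necessity._ The map whose image contains [0 = min E] is a pure
    contraction, and what it sends to the left of [t] lies in [Gamma]; hence
    its ratio is [beta ^ k] with [k > 0], and [beta ^ k * t] has a finite
    expansion [s], with last nonzero digit [s_l] ([contraction_digits]).
    If [l >= k], then raising by [N] the digit at position [l] gives a point
    of [beta ^ k * E], hence of [E], although no point of [E] has a digit above
    [N] there ([digits_before_scale]). So [l < k], which forces [t > 2]
    ([translation_gt2]). Now [Gamma] and [Gamma + t] are far apart, and every
    generating map whose image of [E] meets [Gamma] sends both halves of [E] to
    cylinders of [Gamma], which are translates of each other by
    [beta ^ m * t]. So in the expansion of every point of [Gamma] there is a
    place where either adding [s] or subtracting [s] keeps all the digits in
    [0, N] ([covering_by_pairs], [digit_difference]).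
    - If [s] had two nonzero digits at distance [D], the point whose digits
      alternate between [D] zeros and [D] times [N] would violate this: one of
      the two digits blocks the addition and the other the subtraction.
    - If the only nonzero digit [j] had [2 * j > N + 1], the point with all
      digits [j - 1] would violate it.

    _Sufficiency_ ([self_similar_union]). If [beta ^ k * t = j * d], then a
    copy of [E] scaled by [beta ^ k] is a pair of level-[k] cylinders whose
    first digits differ by [j]. Since [2 * j <= N + 1], every digit [i]
    satisfies [i + j <= N] or [j <= i], so such pairs cover [Gamma]; with
    their translates by [t] they cover [E]. *)

(** * Finite digit expansions *)

Definition spacing (R : realType) (N : nat) (beta : R) : R := (1 - beta) / N%:R.

Definition expansion (R : realType) (N : nat) (beta : R) (x : nat -> nat)
    (n : nat) : R :=
  \sum_(j < n) (x j)%:R * spacing N beta * beta ^+ j.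

Section Expansion.
Variables (R : realType) (N : nat) (beta : R).
Local Notation d := (spacing N beta).
Local Notation V := (expansion N beta).

Lemma expansionS x n : V x n.+1 = (x 0)%:R * d + beta * V (x \o S) n.
Proof.
rewrite /expansion big_ord_recl expr0 mulr1; congr (_ + _).
by rewrite mulr_sumr; apply: eq_bigr => i _; rewrite lift0 exprS mulrCA.
Qed.

Lemma expansion_cat x m n :
  V x (m + n) = V x m + beta ^+ m * V (fun j => x (m + j)%N) n.
Proof.
rewrite /expansion big_split_ord /=; congr (_ + _).
by rewrite mulr_sumr; apply: eq_bigr => i _; rewrite exprD mulrCA.
Qed.

Lemma eq_expansion x y n :
  (forall j, (j < n)%N -> x j = y j) -> V x n = V y n.
Proof. by move=> e; apply: eq_bigr => i _; rewrite e. Qed.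

Lemma expansionD x y n : V (fun j => x j + y j)%N n = V x n + V y n.
Proof.
by rewrite /expansion -big_split; apply: eq_bigr => i _; rewrite natrD !mulrDl.
Qed.

Lemma expansion0 n : V (fun=> 0%N) n = 0.
Proof. by apply: big1 => i _; rewrite !mul0r. Qed.

Lemma expansion_shift x m n :
  V (fun j => if (j < m)%N then 0%N else x (j - m)%N) (m + n) =
  beta ^+ m * V x n.
Proof.
rewrite expansion_cat (@eq_expansion _ (fun=> 0%N)) => [|j -> //].
rewrite expansion0 add0r; congr (_ * _); apply: eq_expansion => j _.
by rewrite ltnNge leq_addr /= addKn.
Qed.

Lemma expansion_single a l n : (l < n)%N ->
  V (fun j => if j == l then a else 0%N) n = a%:R * d * beta ^+ l.
Proof.
move=> ln; rewrite /expansion (bigD1 (Ordinal ln)) //= eqxx big1 ?addr0 //.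
by move=> i; rewrite -val_eqE /= => /negPf ->; rewrite !mul0r.
Qed.

Lemma expansion_trunc x m n : (m <= n)%N ->
  (forall j, (m <= j)%N -> x j = 0%N) -> V x n = V x m.
Proof.
move=> /subnKC <- x0; rewrite expansion_cat (@eq_expansion (fun j => x (m + j)%N) (fun=> 0%N)).
  by rewrite expansion0 mulr0 addr0.
by move=> j _; rewrite x0 // leq_addr.
Qed.

End Expansion.

(** * Digits and hull of the attractor *)

Section Attractor.
Variables (R : realType) (N : nat) (beta : R) (Gamma : set R).
Hypotheses (N_gt0 : (0 < N)%N) (beta_bnd : 0 < beta < 1 / (2 * N%:R + 1)).
Hypothesis Gamma_attr : is_attractor N beta Gamma.
Local Notation d := (spacing N beta).
Local Notation V := (expansion N beta).
Implicit Types (r c u v y z : R) (x : nat -> nat).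

Lemma beta_gt0 : 0 < beta. Proof. by case/andP: beta_bnd. Qed.

Lemma natN_ge1 : 1 <= N%:R :> R. Proof. by rewrite ler1n. Qed.

Lemma beta_lt13 : 3 * beta < 1.
Proof.
case/andP: beta_bnd => b0; have := natN_ge1 => N1.
by rewrite ltr_pdivlMr; nra.
Qed.

Lemma mulN_spacing : N%:R * d = 1 - beta.
Proof. by rewrite /spacing mulrC divfK // pnatr_eq0 -lt0n. Qed.

(** The form in which the bound on [beta] is used: neighbouring first-level
    pieces of the set of sums with digits in [0, 2N], which have length
    [2 * beta], are disjoint. *)
Lemma spacing_gt : 2 * beta < d.
Proof.
have N1 := natN_ge1; have Nd := mulN_spacing.
case/andP: beta_bnd => b0; rewrite ltr_pdivlMr; last nra.
by move=> bN; rewrite ltNge; apply/negP => dle; nra.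
Qed.

Lemma spacing_gt0 : 0 < d.
Proof. by have := spacing_gt; have := beta_gt0; lra. Qed.

Lemma digit_gap i j : (i < j)%N -> i%:R * d + d <= j%:R * d.
Proof.
move=> ij; rewrite -[X in _ + X]mul1r -mulrDl natr1.
by rewrite ler_pM2r ?spacing_gt0 // ler_nat.
Qed.

Lemma beta_scale c y : 0 <= y <= c -> 0 <= beta * y <= c * beta.
Proof. by have := beta_gt0; nra. Qed.

Lemma expr_beta_gt0 n : 0 < beta ^+ n.
Proof. exact/exprn_gt0/beta_gt0. Qed.

Lemma expr_beta_le1 n : beta ^+ n <= 1.
Proof.
by apply: exprn_ile1; [exact/ltW/beta_gt0|have := beta_lt13; have := beta_gt0; lra].
Qed.

Lemma ltr_expr_beta m n : (beta ^+ m < beta ^+ n) = (n < m)%N.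
Proof. by rewrite ltr_iXn2l ?beta_gt0 //; have := beta_lt13; have := beta_gt0; lra. Qed.

Lemma expr_beta_small (e : R) : 0 < e -> exists n, beta ^+ n < e.
Proof.
move=> e0; have b1 : `|beta| < 1.
  by rewrite gtr0_norm ?beta_gt0//; have := beta_lt13; have := beta_gt0; lra.
have /cvgrPdist_lt /(_ _ e0) [n _ /(_ n (leqnn n))] := cvg_expr b1.
by rewrite sub0r normrN gtr0_norm ?expr_beta_gt0// => ?; exists n.
Qed.

Lemma attractor_digit i y : (i <= N)%N -> Gamma y -> Gamma (i%:R * d + beta * y).
Proof.
move=> iN Gy; case: Gamma_attr => _ _ ->.
exists (Ordinal (iN : (i < N.+1)%N)) => //; exists y => //.
by rewrite /phi /similitude /= addrC.
Qed.

Lemma attractor_digitP z : Gamma z ->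
  exists i y, [/\ (i <= N)%N, Gamma y & z = i%:R * d + beta * y].
Proof.
case: Gamma_attr => _ _ {1}-> [i _ [y Gy <-]]; exists i, y; split => //.
  by rewrite -ltnS.
by rewrite /phi /similitude addrC.
Qed.

Lemma attractor_nonempty : exists y, Gamma y.
Proof. by case: Gamma_attr. Qed.

Lemma attractor_bounds z : Gamma z -> 0 <= z <= 1.
Proof.
have b0 := beta_gt0; have b3 := beta_lt13; have d0 := spacing_gt0.
have [M HM] : exists M, forall z, Gamma z -> `|z| <= M.
  case: Gamma_attr => _ /compact_bounded [M [_ HM]] _.
  by exists (M + 1) => x Gx; apply: (HM (M + 1)) => //; rewrite ltrDl.
(* A point is an affine image of another one with ratio beta, and the map
   preserves [0, 1]: a bound on the excess over [0, 1] shrinks by beta. *)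
have step n : forall z, Gamma z -> - (M * beta ^+ n) <= z <= 1 + M * beta ^+ n.
  elim: n => [|n IH] x Gx.
    by have := HM _ Gx; rewrite ler_norml expr0; lra.
  have [i [y [iN Gy ->]]] := attractor_digitP Gx.
  have := IH _ Gy; have Nd := mulN_spacing.
  have iNR : i%:R <= N%:R :> R by rewrite ler_nat.
  have i0 : 0 <= i%:R :> R by [].
  rewrite exprS; move: (M * beta ^+ n) (beta ^+ n) => u v.
  by move=> /andP[h1 h2]; apply/andP; split; nra.
move=> Gz; have M0 : 0 <= M by apply: le_trans (HM _ Gz).
rewrite !leNgt; apply/andP; split; apply/negP => zlt.
- have [|n hn] := @expr_beta_small (- z / (M + 1)); first by apply: divr_gt0; lra.
  have /andP[h _] := step n _ Gz; move: hn; rewrite ltr_pdivlMr; last lra.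
  by have := expr_beta_gt0 n; nra.
have [|n hn] := @expr_beta_small ((z - 1) / (M + 1)); first by apply: divr_gt0; lra.
have /andP[_ h] := step n _ Gz; move: hn; rewrite ltr_pdivlMr; last lra.
by have := expr_beta_gt0 n; nra.
Qed.

Lemma attractor_bounds2 z : Gamma z -> 0 <= z <= 2.
Proof. by move=> /attractor_bounds; lra. Qed.

Lemma attractor_expansion x n y : (forall j, (x j <= N)%N) -> Gamma y ->
  Gamma (V x n + beta ^+ n * y).
Proof.
elim: n x => [|n IH] x xN Gy; first by rewrite /expansion big_ord0 add0r mul1r.
rewrite expansionS exprS -mulrA -addrA -mulrDr.
by apply: attractor_digit => //; apply: IH => // j; exact: xN.
Qed.

Lemma attractor_expansionP z n : Gamma z -> exists x y,
  [/\ forall j, (x j <= N)%N, Gamma y & z = V x n + beta ^+ n * y].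
Proof.
elim: n z => [|n IH] z Gz.
  by exists (fun=> 0%N), z; split => //; rewrite /expansion big_ord0 add0r mul1r.
have [i [z' [iN Gz' ->]]] := attractor_digitP Gz.
have [x [y [xN Gy ->]]] := IH _ Gz'.
exists (fun j => if j is j'.+1 then x j' else i), y; split => //; first by case.
by rewrite expansionS exprS /=; ring.
Qed.

(** Points of [Gamma] are often known only through their finite expansions;
    closedness of [Gamma] lets these decide membership. *)
Lemma attractor_closed z :
  (forall n, exists2 c, Gamma c & `|z - c| <= beta ^+ n) -> Gamma z.
Proof.
move=> H; have [_ cG _] := Gamma_attr.
have clG : closed Gamma by apply: compact_closed cG; exact: Rhausdorff.
apply: clG => B /nbhs_ballP [e /= e0 HB].
have [n hn] := expr_beta_small e0; have [c Gc hc] := H n.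
by exists c; split => //; apply: HB; apply: le_lt_trans hn.
Qed.

Lemma attractor0 : Gamma 0.
Proof.
have [y Gy] := attractor_nonempty; apply: attractor_closed => n.
exists (V (fun=> 0%N) n + beta ^+ n * y); first exact: attractor_expansion.
have := attractor_bounds Gy; have := expr_beta_gt0 n.
by rewrite expansion0 ler_norml; nra.
Qed.

(** The expansion of [1] has all its digits equal to [N]; subtracting digitwise
    from it is what makes [Gamma] symmetric. *)
Lemma expansion_comp x n : (forall j, (x j <= N)%N) ->
  V (fun j => N - x j)%N n = 1 - beta ^+ n - V x n.
Proof.
elim: n x => [|n IH] x xN; first by rewrite /expansion !big_ord0 expr0; ring.
rewrite !expansionS (IH (x \o S) (fun j => xN j.+1)) natrB // mulrBl.
by rewrite mulN_spacing exprS; ring.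
Qed.

Lemma attractor_sym z : Gamma z -> Gamma (1 - z).
Proof.
move=> Gz; apply: attractor_closed => n.
have [x [y [xN Gy ->]]] := attractor_expansionP n Gz.
exists (V (fun j => N - x j)%N n + beta ^+ n * 0).
  by apply: attractor_expansion attractor0 => j; rewrite leq_subr.
rewrite expansion_comp //; have := attractor_bounds Gy.
by have := expr_beta_gt0 n; rewrite ler_norml; nra.
Qed.

Lemma attractor1 : Gamma 1.
Proof. by rewrite -(subr0 1); apply/attractor_sym/attractor0. Qed.

Lemma expansion_attractor x n : (forall j, (x j <= N)%N) -> Gamma (V x n).
Proof.
by move=> xN; rewrite -(addr0 (V x n)) -(mulr0 (beta ^+ n));
  apply: attractor_expansion attractor0.
Qed.

Lemma expansion_ge0 x n : 0 <= V x n.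
Proof.
apply: sumr_ge0 => i _; apply: mulr_ge0; last exact/ltW/expr_beta_gt0.
by apply: mulr_ge0 => //; exact/ltW/spacing_gt0.
Qed.

Lemma expansion_le x n (c : nat) : (forall j, (x j <= c * N)%N) ->
  V x n + beta ^+ n * c%:R <= c%:R.
Proof.
elim: n x => [|n IH] x xN; first by rewrite /expansion big_ord0 expr0; lra.
have b0 := beta_gt0; have d0 := spacing_gt0; have Nd := mulN_spacing.
have x0 : (x 0)%:R <= c%:R * N%:R :> R by rewrite -natrM ler_nat.
rewrite expansionS exprS; have := IH (x \o S) (fun j => xN j.+1).
have c0 : 0 <= c%:R :> R by []. 
move: (V _ n) (beta ^+ n) => u v H.
by have : c%:R * (N%:R * d) = c%:R * (1 - beta); [rewrite Nd|nra].
Qed.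

Lemma leq_double_digits x :
  (forall j, (x j <= N)%N) -> forall j, (x j <= 2 * N)%N.
Proof. by move=> xN j; apply: leq_trans (xN j) _; rewrite leq_pmull. Qed.

(** Uniqueness of expansions with digits up to [2N]: the tails lie in [0, 2],
    so after scaling they differ by at most [2 * beta < d], less than what one
    unit in the first digit contributes. *)
Lemma expansion_inj x x' n (y y' : R) :
  (forall j, (x j <= 2 * N)%N) -> (forall j, (x' j <= 2 * N)%N) ->
  0 <= y <= 2 -> 0 <= y' <= 2 ->
  V x n + beta ^+ n * y = V x' n + beta ^+ n * y' ->
  y = y' /\ forall j, (j < n)%N -> x j = x' j.
Proof.
move=> xN x'N hy hy'; elim: n x x' xN x'N => [|n IH] x x' xN x'N.
  by rewrite /expansion !big_ord0 !add0r !mul1r => ->.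
rewrite !expansionS exprS -!mulrA -!addrA -!mulrDr.
have tail w z : (forall j, (w j <= 2 * N)%N) -> 0 <= z <= 2 ->
    0 <= V w n + beta ^+ n * z <= 2.
  move=> wN hz; have := expansion_ge0 w n; have := expansion_le n wN.
  by have := expr_beta_gt0 n; nra.
have h := tail _ _ (fun j => xN j.+1) hy.
have h' := tail _ _ (fun j => x'N j.+1) hy'.
move: (IH _ _ (fun j => xN j.+1) (fun j => x'N j.+1)) h h'.
have b0 := beta_gt0; have db := spacing_gt; have d0 := spacing_gt0.
have -> : V (fun j => x j.+1) n = V (x \o S) n by [].
have -> : V (fun j => x' j.+1) n = V (x' \o S) n by [].
move: (_ + _ * y) (_ + _ * y') => u u' {}IH h h' e.
have x00 : x 0%N = x' 0%N.
  have bu := beta_scale h; have bu' := beta_scale h'.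
  by case: (ltngtP (x 0%N) (x' 0%N)) => // /digit_gap ?; exfalso; lra.
have uu' : u = u'.
  apply: (@mulfI R beta); first by rewrite gt_eqF.
  by apply: (@addrI R ((x 0)%:R * d)); rewrite e x00.
have [-> H] := IH uu'; split => // -[//|j] jn; exact: H.
Qed.

(** * Affine copies of the attractor inside itself *)

(** The gap after the [i]-th first-level piece has length [d - beta]: a shorter
    step from a point left of it cannot jump over it. *)
Lemma attractor_cross i u v : Gamma v -> u <= i%:R * d + beta ->
  v - u < d - beta -> v <= i%:R * d + beta.
Proof.
move=> Gv ui vu; have [j [y [_ Gy ev]]] := attractor_digitP Gv.
have by01 := beta_scale (attractor_bounds Gy).
have [ji|/digit_gap] := leqP j i; last by rewrite ev in vu *; lra.
have : j%:R * d <= i%:R * d by rewrite ler_pM2r ?spacing_gt0 // ler_nat.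
by rewrite ev; lra.
Qed.

(** If [r < 1], the ends of the images of the first-level pieces form a chain
    from [c] to [c + r] inside [Gamma] with steps shorter than [d - beta]; it
    stays in one first-level piece, and then so does the whole copy. Blowing up
    that piece replaces [r] by [r / beta], which stops when [r = 1]. *)
Lemma attractor_embed r c : 0 < r ->
  (forall y, Gamma y -> Gamma (r * y + c)) ->
  exists k x, [/\ forall j, (x j <= N)%N, r = beta ^+ k & c = V x k].
Proof.
move=> r0; have [M /ltW] := expr_beta_small r0.
have b0 := beta_gt0; have db := spacing_gt; have Nd := mulN_spacing.
elim: M r c r0 => [|M IH] r c r0 rM emb.
all: have Gc := emb _ attractor0; rewrite mulr0 add0r in Gc.
all: have G1 := emb _ attractor1; rewrite mulr1 in G1.
all: have c01 := attractor_bounds Gc; have rc01 := attractor_bounds G1.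
  exists 0%N, (fun=> 0%N); rewrite /expansion big_ord0 expr0 in rM *.
  by split => //; lra.
have [r1|r1] := leP 1 r.
  exists 0%N, (fun=> 0%N); rewrite /expansion big_ord0 expr0.
  by split => //; lra.
have [i [y0 [iN Gy0 ec]]] := attractor_digitP Gc.
have by0 := beta_scale (attractor_bounds Gy0).
have rb : r * beta < beta by rewrite gtr_pMl.
have rdb : r * (d - beta) < d - beta by rewrite gtr_pMl //; lra.
have chain l : (l <= N)%N -> r * (l%:R * d) + c <= i%:R * d + beta /\
    r * (l%:R * d + beta) + c <= i%:R * d + beta.
  elim: l => [|l IHl] lN.
    have c_le : c <= i%:R * d + beta by rewrite ec; lra.
    rewrite mul0r mulr0 !add0r; split => //.
    apply: (attractor_cross (u := c)) => //; last lra.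
    apply: emb; have := attractor_digit (leq0n N) attractor1.
    by rewrite mul0r add0r mulr1.
  have [_ hl] := IHl (ltnW lN).
  have h1 : r * (l.+1%:R * d) + c <= i%:R * d + beta.
    apply: attractor_cross hl _; last by rewrite -natr1; lra.
    apply: emb; have := attractor_digit lN attractor0.
    by rewrite mulr0 addr0.
  split=> //; apply: attractor_cross h1 _; last lra.
  by apply: emb; have := attractor_digit lN attractor1; rewrite mulr1.
have [_ top] := chain _ (leqnn N); rewrite Nd subrK mulr1 in top.
have {chain top}emb' y : Gamma y -> Gamma (r / beta * y + y0).
  move=> Gy; have Gz := emb _ Gy; have y01 := attractor_bounds Gy.
  have [j [y' [_ Gy' ez]]] := attractor_digitP Gz.
  have by' := beta_scale (attractor_bounds Gy').
  have ry : 0 <= r * y <= r.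
    by case/andP: y01 => y_ge0 y_le1; rewrite ger_pMr // y_le1 mulr_ge0 // ltW.
  have -> : r / beta * y + y0 = y'; last by [].
  have eji : j = i.
    by case: (ltngtP j i) => // /digit_gap ?; exfalso; lra.
  apply: (@mulfI R beta); first by rewrite gt_eqF.
  apply: (@addrI R (j%:R * d)); rewrite -ez ec eji.
  by field; rewrite gt_eqF.
have [||k [x [xN er ey0]]] := IH (r / beta) y0 _ _ emb'.
- exact: divr_gt0.
- by rewrite ler_pdivlMr // mulrC -exprS.
exists k.+1, (fun j => if j is j'.+1 then x j' else i); split.
- by case.
- by rewrite exprS -er; field; rewrite gt_eqF.
- by rewrite expansionS ec ey0.
Qed.

(** * The union with a translate *)

Lemma attractor_scale n y : Gamma y -> Gamma (beta ^+ n * y).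
Proof.
move=> Gy; rewrite -[X in Gamma X]add0r -(expansion0 N beta n).
exact: attractor_expansion.
Qed.

Lemma last_digit x n : V x n != 0 ->
  exists l, [/\ (l < n)%N, (0 < x l)%N & forall j, (l < j < n)%N -> x j = 0%N].
Proof.
elim: n => [|n IH]; first by rewrite /expansion big_ord0 eqxx.
have [x0|xn] := posnP (x n); last first.
  by move=> _; exists n; split => // j; case: ltngtP; lia.
rewrite /expansion big_ord_recr /= x0 !mul0r addr0 => /IH[l [ln xl H]].
exists l; split => // [|j /andP[lj]]; first exact: ltnW.
by rewrite ltnS leq_eqVlt => /predU1P[->//|jn]; apply: H; rewrite lj.
Qed.

Section Union.
Variable t : R.
Hypothesis t_gt0 : 0 < t.
Local Notation E := (Gamma `|` translate Gamma t).

Lemma unionP z : E z <-> Gamma z \/ Gamma (z - t).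
Proof.
split=> [[?|[y Gy <-]]|[?|Gz]]; [by left|by right; rewrite addrK|by left|].
by right; exists (z - t) => //; rewrite subrK.
Qed.

Lemma union_l z : Gamma z -> E z. Proof. by left. Qed.

Lemma union_r z : Gamma z -> E (z + t).
Proof. by move=> Gz; apply/unionP; right; rewrite addrK. Qed.

Lemma union_ge0 z : E z -> 0 <= z.
Proof. by case/unionP => /attractor_bounds; have := t_gt0; lra. Qed.

Lemma union_sym z : E z -> E (1 + t - z).
Proof.
case/unionP => /attractor_sym Gz; apply/unionP; [right|left].
- by have -> : 1 + t - z - t = 1 - z by ring.
- by have <- : 1 - (z - t) = 1 + t - z by ring.
Qed.

Lemma union_lt z : E z -> z < t -> Gamma z.
Proof. by case/unionP => // /attractor_bounds/andP[z0 _] zt; lra. Qed.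

(** A decreasing similitude composed with the symmetry of [E] about its centre
    is increasing and has the same image of [E]. *)
Lemma increasing_maps : self_similar E -> exists n (r b : 'I_n -> R),
  [/\ forall i, 0 < r i < 1,
      forall i z, E z -> E (r i * z + b i) &
      forall z, E z -> exists i w, E w /\ z = r i * w + b i].
Proof.
case=> _ _ [n [r [b [rb EE]]]].
have Emap i z : E z -> E (r i * z + b i).
  by move=> Ez; rewrite EE; exists i => //; exists z.
exists n, (fun i => `|r i|), (fun i => if r i < 0 then b i + r i * (1 + t) else b i).
split=> [//|i z Ez|z].
  have [r0|r0] := ltP (r i) 0; last by rewrite ger0_norm //; exact: Emap.
  rewrite ltr0_norm //.
  have -> : - r i * z + (b i + r i * (1 + t)) = r i * (1 + t - z) + b i by ring.
  exact/Emap/union_sym.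
rewrite {1}EE => -[i _ [w Ew <-]]; exists i.
have [r0|r0] := ltP (r i) 0.
  exists (1 + t - w); split; first exact: union_sym.
  by rewrite ltr0_norm // /similitude; ring.
by exists w; rewrite ger0_norm.
Qed.

(** The map whose image contains the minimum [0] must send [0] to [0]. *)
Lemma contraction_at0 : self_similar E ->
  exists2 r, 0 < r < 1 & forall z, E z -> E (r * z).
Proof.
case/increasing_maps => n [r [b [r01 Emap Ecov]]].
have [i [w [Ew ew]]] := Ecov 0 (union_l attractor0).
exists (r i) => // z Ez.
have := Emap i 0 (union_l attractor0); rewrite mulr0 add0r => /union_ge0 b0.
suff -> : r i * z = r i * z + b i by exact: Emap.
have := mulr_ge0 (ltW (proj1 (andP (r01 i)))) (union_ge0 Ew); lra.
Qed.

(** Since [r * t < t], a small cylinder at the left end of [Gamma], or of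
    [Gamma + t], is mapped to the left of [t], hence into [Gamma]; there
    [attractor_embed] applies. *)
Lemma contraction_at0_power r : 0 < r < 1 -> (forall z, E z -> E (r * z)) ->
  exists k n s, [/\ (0 < k)%N, forall j, (s j <= N)%N,
    r = beta ^+ k & r * t = V s n].
Proof.
move=> /andP[r0 r1] Emap.
have [|m hm] := @expr_beta_small (t * (1 - r)).
  by rewrite mulr_gt0 // subr_gt0.
have bm0 := expr_beta_gt0 m; have b0 := beta_gt0.
have small y : Gamma y -> 0 <= r * (beta ^+ m * y) <= r * beta ^+ m.
  move=> /attractor_bounds/andP[y0 y1].
  rewrite !mulr_ge0 ?(ltW r0) ?(ltW bm0) //=.
  by rewrite ler_pM2l // ger_pMr.
have rbm : r * beta ^+ m < beta ^+ m by rewrite gtr_pMl.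
have rt0 : 0 < r * t by rewrite mulr_gt0.
have emb1 y : Gamma y -> Gamma (r * beta ^+ m * y + 0).
  move=> Gy; rewrite addr0 -mulrA; apply: union_lt.
    exact/Emap/union_l/attractor_scale.
  by have := small _ Gy; lra.
have emb2 y : Gamma y -> Gamma (r * beta ^+ m * y + r * t).
  move=> Gy; rewrite -mulrA -mulrDr; apply: union_lt.
    exact/Emap/union_r/attractor_scale.
  by rewrite mulrDr; have := small _ Gy; lra.
have [|k' [_ [_ ek' _]]] := attractor_embed _ emb1; first exact: mulr_gt0.
have [|n [s [sN _ es]]] := attractor_embed _ emb2; first exact: mulr_gt0.
have mk' : (m < k')%N by rewrite -ltr_expr_beta -ek'.
exists (k' - m)%N, n, s; split => //; first by rewrite subn_gt0.
apply: (@mulIf R (beta ^+ m)); first by rewrite gt_eqF.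
by rewrite ek' -exprD subnK // ltnW.
Qed.

(** The expansion of [beta ^ k * t] cut after its last nonzero digit [s l]. *)
Lemma contraction_digits : self_similar E -> exists k l s,
  [/\ (0 < k)%N, forall j, (s j <= N)%N, (0 < s l)%N,
      forall j, (l < j)%N -> s j = 0%N &
      beta ^+ k * t = V s l.+1 /\ forall z, E z -> E (beta ^+ k * z)].
Proof.
move=> /contraction_at0 [r r01 Emap].
have [k [n [s [k0 sN er es]]]] := contraction_at0_power r01 Emap.
have [|l [ln sl s0]] := @last_digit s n.
  by rewrite -es gt_eqF // mulr_gt0 //; case/andP: r01.
exists k, l, (fun j => if (l < j)%N then 0%N else s j); split => //.
- by move=> j; case: ifP.
- by rewrite ltnn.
- by move=> j ->.
split=> [|z]; last by rewrite -er; exact: Emap.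
rewrite -er es -[RHS](@expansion_trunc _ _ _ _ _ n) //; last by move=> j ->.
by apply: eq_expansion => j jn; case: ifP => // lj; rewrite s0 // lj.
Qed.

(** Otherwise [top + t], with [top] having the single digit [N] at position
    [l - k], is a point of [E] whose image under the contraction has digit
    [s l + N > N] at position [l]. A point of [Gamma] has no such digit; nor
    has a point of [Gamma + t] in this situation, because then [t < 1] and the
    expansion of [t], which is that of [beta ^ k * t] shifted by [k > 0]
    places, has ended before position [l]. *)
Lemma digits_before_scale k l s : (0 < k)%N -> (forall j, (s j <= N)%N) ->
  (0 < s l)%N -> (forall j, (l < j)%N -> s j = 0%N) ->
  beta ^+ k * t = V s l.+1 -> (forall z, E z -> E (beta ^+ k * z)) ->
  (l < k)%N.
Proof.
move=> k0 sN sl s0 es Emap; rewrite ltnNge; apply/negP => kl.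
have zero2 := attractor_bounds2 attractor0.
pose q j := (s j + (if j == l then N else 0))%N.
have qN j : (q j <= 2 * N)%N by rewrite /q mul2n -addnn leq_add //; case: ifP.
pose top := V (fun j => if j == (l - k)%N then N else 0%N) (l - k).+1.
have Gtop : Gamma top by apply: expansion_attractor => j; case: ifP.
pose p := beta ^+ k * (top + t).
have ep : p = V q l.+1.
  rewrite /q expansionD expansion_single // -es /p /top expansion_single //.
  have -> : beta ^+ l = beta ^+ k * beta ^+ (l - k) by rewrite -exprD subnKC.
  by ring.
have /unionP[Gp|Gp] := Emap _ (union_r Gtop); rewrite -/p in Gp.
  have [x [y [xN Gy]]] := attractor_expansionP l.+1 Gp.
  rewrite ep -[LHS]addr0 -(mulr0 (beta ^+ l.+1)) => e.
  have [_ /(_ l (ltnSn l))] :=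
    expansion_inj qN (leq_double_digits xN) zero2 (attractor_bounds2 Gy) e.
  by have := xN l; rewrite /q eqxx; lia.
have t2 : 0 <= t <= 2.
  have bk : beta ^+ k <= beta.
    by rewrite -(prednK k0) exprS ger_pMr ?beta_gt0 ?expr_beta_le1.
  have /andP[top0 top1] := attractor_bounds Gtop.
  have pb : p <= beta * (top + t) by rewrite ler_wpM2r // addr_ge0 // ltW.
  have : beta * (top + t) <= beta * (1 + t) by rewrite ler_pM2l ?beta_gt0 //; lra.
  have : beta * (3 * (1 + t)) <= 1 + t.
    by rewrite mulrCA mulrA ger_pMl; [exact/ltW/beta_lt13|by rewrite addr_gt0].
  by have := attractor_bounds Gp; have := t_gt0; lra.
pose u j := s (k + j)%N.
have uN j : (u j <= N)%N by exact: sN.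
have et : t = V u (l - k).+1.
  move: es; rewrite -(subnKC kl) -addnS expansion_cat -/u.
  rewrite -[LHS]add0r -{1}(expansion0 N beta k) => e.
  have Gu := expansion_attractor (l - k).+1 uN.
  rewrite addKn; have [//] := expansion_inj (fun=> leq0n _)
    (leq_double_digits sN) t2 (attractor_bounds2 Gu) e.
have {}et : t = V u l.+1.
  rewrite et; apply/esym/expansion_trunc; first by rewrite ltnS leq_subr.
  by move=> j lkj; apply: s0; lia.
have [x [y [xN Gy]]] := attractor_expansionP l.+1 Gp.
move/eqP; rewrite subr_eq ep {1}et addrAC -expansionD => /eqP.
rewrite -[LHS]addr0 -(mulr0 (beta ^+ l.+1)) => e.
have xuN j : (x j + u j <= 2 * N)%N by rewrite mul2n -addnn leq_add.
have [_ /(_ l (ltnSn l))] := expansion_inj qN xuN zero2 (attractor_bounds2 Gy) e.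
by have := xN l; have : u l = 0%N; [apply: s0; lia|rewrite /q eqxx; lia].
Qed.

(** A nonzero digit at position [l < k] makes [t >= d / beta > 2]. *)
Lemma translation_gt2 k l s : (l < k)%N -> (0 < s l)%N ->
  beta ^+ k * t = V s l.+1 -> 2 < t.
Proof.
move=> lk sl; rewrite /expansion big_ord_recr /= -/(V s l).
have := expansion_ge0 s l; have := expr_beta_gt0 k; have := expr_beta_gt0 l.
have : beta ^+ k <= beta ^+ l * beta.
  rewrite -exprSr -(subnK lk) exprD ler_piMl ?expr_beta_le1 //.
  exact/ltW/expr_beta_gt0.
have : 1 <= (s l)%:R :> R by rewrite ler1n.
have := spacing_gt; have := beta_gt0; have := spacing_gt0.
move: (beta ^+ k) (beta ^+ l) (V s l) (s l)%:R => u v w a.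
move=> d0 b0 db a1 uv v0 u0 w0 e.
have h1 : d * v <= a * d * v by rewrite -mulrA ler_peMl // mulr_ge0 ?ltW.
have h2 : 2 * beta * v < d * v by rewrite ltr_pM2r.
by rewrite -(ltr_pM2l u0); lra.
Qed.

(** Take the point of [Gamma] with the digits of [x], truncated beyond the level
    of every generating map, and a map whose image of [E] contains it. As
    [t > 2], that map sends both [Gamma] and [Gamma + t] into [Gamma], thus
    onto two cylinders of the same level [k], and the point determines the
    digits of the one that contains it. *)
Lemma covering_by_pairs : self_similar E -> 2 < t -> forall x,
  (forall j, (x j <= N)%N) -> exists k x', (forall j, (x' j <= N)%N) /\
  (beta ^+ k * t = V x' k - V x k \/ beta ^+ k * t = V x k - V x' k).
Proof.
move=> /increasing_maps [n [r [b [r01 Emap Ecov]]]] t2 x xN.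
have /boolp.choice[m hm] i : exists m, beta ^+ m < r i.
  by apply: expr_beta_small; case/andP: (r01 i).
pose M := \max_i m i.
have Gz := expansion_attractor M xN; set z := V x M in Gz.
have [i [w [Ew ez]]] := Ecov _ (union_l Gz).
have /andP[r0 r1] := r01 i; have z01 := attractor_bounds Gz.
have bz : b i <= z by rewrite ez lerDr mulr_ge0 ?(ltW r0) // union_ge0.
have Gb : Gamma (b i).
  apply: union_lt; last lra.
  by rewrite -[b i]add0r -(mulr0 (r i)); exact/Emap/union_l/attractor0.
have b01 := attractor_bounds Gb.
have ry y : Gamma y -> 0 <= r i * y <= r i.
  by move=> /attractor_bounds/andP[y0 y1]; rewrite mulr_ge0 ?(ltW r0)//= ger_pMr.
have emb1 y : Gamma y -> Gamma (r i * y + b i).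
  move=> Gy; apply: union_lt; first exact/Emap/union_l.
  by have := ry _ Gy; lra.
have br1 : r i + b i <= 1.
  by have := attractor_bounds (emb1 _ attractor1); rewrite mulr1 => /andP[].
(* If the image of [t] lay in [Gamma + t], then [t * (1 - r i) <= b i], while
   [b i <= 1 - r i]: this contradicts [1 < t]. *)
have Gt : Gamma (r i * t + b i).
  have := Emap i _ (union_r attractor0); rewrite add0r => /unionP[//|].
  by move=> /attractor_bounds/andP[+ _]; nra.
have emb2 y : Gamma y -> Gamma (r i * y + (r i * t + b i)).
  move=> Gy; apply: union_lt; first by rewrite addrA -mulrDr; exact/Emap/union_r.
  by have := ry _ Gy; have := attractor_bounds Gt; lra.
have [k [x1 [x1N ek e1]]] := attractor_embed r0 emb1.
have [k2 [x2 [x2N ek2 e2]]] := attractor_embed r0 emb2.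
have kM : (k <= M)%N.
  apply: ltnW; rewrite -ltr_expr_beta -ek; apply: le_lt_trans (hm i).
  by rewrite leNgt ltr_expr_beta -leqNgt leq_bigmax.
have {ek2}k2k : k2 = k.
  by case: (ltngtP k2 k) => //; rewrite -ltr_expr_beta -ek -ek2 ltxx.
rewrite {}k2k in e2.
have same a y : (forall j, (a j <= N)%N) -> Gamma y ->
    z = V a k + beta ^+ k * y -> V a k = V x k.
  move=> aN Gy; rewrite /z -{1}(subnKC kM) expansion_cat => e.
  have Gx := expansion_attractor (M - k) (fun j => xN (k + j)%N).
  have [_ H] := expansion_inj (leq_double_digits xN)
    (leq_double_digits aN) (attractor_bounds2 Gx) (attractor_bounds2 Gy) e.
  by apply/esym/eq_expansion.
exists k; case/unionP: Ew => Gw.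
- exists x2; split => //; left.
  by rewrite -(same x1 w) // -?e1 -?e2 -?ek ?ez; ring.
- exists x1; split => //; right.
  by rewrite -(same x2 (w - t)) // -?e1 -?e2 -?ek ?ez; ring.
Qed.

(** Multiplying [V x' m - V x m = beta ^ m * t] by [beta ^ k] turns it into an
    equation between expansions of length [k + m] in which the digits of [s]
    start at position [m] and those of [x] and [x'] at position [k]. It is
    carry-free because the sums of two digits are at most [2N]. *)
Lemma digit_difference k l s m x x' : (l < k)%N ->
  (forall j, (s j <= N)%N) -> (forall j, (l < j)%N -> s j = 0%N) ->
  beta ^+ k * t = V s l.+1 ->
  (forall j, (x j <= N)%N) -> (forall j, (x' j <= N)%N) ->
  beta ^+ m * t = V x' m - V x m ->
  forall p, (0 < s p)%N ->
    (k <= m + p)%N /\ x' (m + p - k)%N = (x (m + p - k) + s p)%N.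
Proof.
move=> lk sN s0 es xN x'N e p sp.
pose sh (a : nat -> nat) i j := if (j < i)%N then 0%N else a (j - i)%N.
have shN a i : (forall j, (a j <= N)%N) -> forall j, (sh a i j <= N)%N.
  by move=> aN j; rewrite /sh; case: ifP.
have esk : V s k = V s l.+1 by exact: expansion_trunc.
have e' : V (fun j => sh x k j + sh s m j)%N (k + m) + beta ^+ (k + m) * 0 =
          V (sh x' k) (k + m) + beta ^+ (k + m) * 0.
  rewrite !mulr0 !addr0 expansionD {2}[in LHS](addnC k) !expansion_shift esk -es.
  by rewrite mulrCA e; ring.
have zero2 := attractor_bounds2 attractor0.
have aN j : (sh x k j + sh s m j <= 2 * N)%N by rewrite mul2n -addnn leq_add ?shN.
have bN j : (sh x' k j <= 2 * N)%N by have := shN _ k x'N j; lia.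
have pl : (p <= l)%N by rewrite leqNgt; apply/negP => /s0; lia.
have [_ /(_ (m + p)%N)] := expansion_inj aN bN zero2 zero2 e'.
have -> : (m + p < k + m)%N by lia.
move=> /(_ isT); rewrite /sh; have -> : (m + p < m)%N = false by lia.
by rewrite addKn; case: ltnP; lia.
Qed.

(** The point with alternating blocks of zeros and [N]s, and the point with all
    digits [s l - 1], rule out a second nonzero digit of [s] and a digit
    [s l] with [2 * s l > N + 1], respectively. *)
Lemma translation_form : self_similar E -> exists j k : nat,
  [/\ (1 <= j <= (N + 1) %/ 2)%N, (0 < k)%N &
      t = j%:R * (1 - beta) / N%:R * beta ^- k].
Proof.
move=> Ess; have [k [l [s [k0 sN sl s0 [es Emap]]]]] := contraction_digits Ess.
have lk := digits_before_scale k0 sN sl s0 es Emap.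
have t2 := translation_gt2 lk sl es.
have shift x : (forall j, (x j <= N)%N) -> exists m,
    (forall p, (0 < s p)%N -> (k <= m + p)%N /\ (x (m + p - k) + s p <= N)%N) \/
    (forall p, (0 < s p)%N -> (k <= m + p)%N /\ (s p <= x (m + p - k))%N).
  move=> xN; have [m [x' [x'N e]]] := covering_by_pairs Ess t2 xN.
  exists m; case: e => e; [left|right] => p sp.
  - have [kp <-] := digit_difference lk sN s0 es xN x'N e sp.
    by split.
  - have [kp ->] := digit_difference lk sN s0 es x'N xN e sp.
    by split => //; rewrite leq_addl.
have only p : (0 < s p)%N -> p = l.
  move=> sp; have [lp|pl|//] := ltngtP l p; first by move: sp; rewrite s0.
  pose D := (l - p)%N; have D0 : (0 < D)%N by rewrite subn_gt0.
  (* Positions at distance D fall into consecutive blocks, so they carry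
     different digits, one 0 and the other N. *)
  have [|m] := shift (fun j => if odd (j %/ D) then N else 0%N).
    by move=> j; case: ifP.
  move=> H.
  have eo : (k <= m + p)%N -> odd ((m + l - k) %/ D) = ~~ odd ((m + p - k) %/ D).
    move=> kp; have -> : (m + l - k = m + p - k + D)%N by rewrite /D; lia.
    by rewrite divnDr // divnn D0 addn1.
  case: H => H; have [kp hp] := H _ sp; have [_ hl] := H _ sl;
  by move: hp hl; rewrite (eo kp); case: (odd _) => /=; lia.
have [|m H] := shift (fun=> (s l).-1); first by move=> _; have := sN l; lia.
have sl2 : (2 * s l <= N + 1)%N by case: H => /(_ _ sl) [_]; lia.
exists (s l), (k - l)%N; split; [|by rewrite subn_gt0|].
  by rewrite sl leq_divRL // mulnC.
have bk := expr_beta_gt0 k; have bkl := expr_beta_gt0 (k - l).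
apply: (@mulfI R (beta ^+ k)); first by rewrite gt_eqF.
rewrite es (@eq_expansion _ _ _ _ (fun j => if j == l then s l else 0%N)).
  have -> : beta ^+ k = beta ^+ (k - l) * beta ^+ l.
    by rewrite -exprD subnK // ltnW.
  rewrite expansion_single // /spacing.
  by field; rewrite pnatr_eq0 -lt0n N_gt0 gt_eqF.
move=> j _; case: eqP => [->//|jl].
by apply/eqP; rewrite -leqn0 leqNgt; apply/negP => /only.
Qed.

End Union.
End Attractor.

(** * Covering the union by copies of itself *)

Section Converse.
Variables (R : realType) (N : nat) (beta : R) (Gamma : set R).
Hypotheses (N_gt0 : (0 < N)%N) (beta_bnd : 0 < beta < 1 / (2 * N%:R + 1)).
Hypothesis Gamma_attr : is_attractor N beta Gamma.
Local Notation d := (spacing N beta).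
Local Notation V := (expansion N beta).

Definition set_first (x : nat -> nat) (a : nat) : nat -> nat :=
  fun j => if j is 0%N then a else x j.

Lemma expansion_set_first x a n :
  V (set_first x a) n.+1 = V x n.+1 + (a%:R - (x 0%N)%:R) * d.
Proof. by rewrite !expansionS /=; ring. Qed.

(** The finite words that index the copies, read as digit sequences; only the
    first [k.+1] values are meaningful. *)
Definition word_digits k (w : {ffun 'I_k.+1 -> 'I_N.+1}) : nat -> nat :=
  fun j => w (inord j).

Lemma word_digits_le k (w : {ffun 'I_k.+1 -> 'I_N.+1}) j : (word_digits w j <= N)%N.
Proof. by rewrite -ltnS ltn_ord. Qed.

Lemma expansion_word x k : (forall j, (x j <= N)%N) ->
  exists w : {ffun 'I_k.+1 -> 'I_N.+1}, V (word_digits w) k.+1 = V x k.+1.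
Proof.
move=> xN; exists [ffun i : 'I_k.+1 => inord (x i)].
apply: eq_expansion => j jk.
by rewrite /word_digits ffunE inordK ?inordK // ltnS.
Qed.

(** A word whose first digit [i] satisfies [i + j <= N] indexes the copy with
    left half in the cylinder of that word; any other word has [j <= i] and
    indexes the copy with right half there. The boolean component of [T] says
    whether the copy is moved from [Gamma] to [Gamma + t]. *)
Lemma self_similar_union j k : (1 <= j <= (N + 1) %/ 2)%N ->
  let t := j%:R * (1 - beta) / N%:R * beta ^- k.+1 in
  self_similar (Gamma `|` translate Gamma t).
Proof.
move=> /andP[j1 jN] t; rewrite leq_divRL // in jN.
have bk0 := expr_beta_gt0 beta_bnd k.+1.
have et : beta ^+ k.+1 * t = j%:R * d.
  by rewrite /t /spacing; field; rewrite pnatr_eq0 -lt0n N_gt0 gt_eqF.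
have Gne : Gamma !=set0 by case: Gamma_attr.
have Gc : compact Gamma by case: Gamma_attr.
pose low (w : {ffun 'I_k.+1 -> 'I_N.+1}) := (word_digits w 0 + j <= N)%N.
pose base w := V (word_digits w) k.+1 - (if low w then 0 else j%:R * d).
pose T := (bool * {ffun 'I_k.+1 -> 'I_N.+1})%type.
pose c (p : T) := base p.2 + (if p.1 then t else 0).
set E := Gamma `|` translate Gamma t.
have inE z : Gamma z -> E z by left.
have inEt z : Gamma z -> E (z + t) by move=> Gz; right; exists z.
have copy_sub w z : E z -> Gamma (beta ^+ k.+1 * z + base w).
  have wN := word_digits_le w.
  have firstN a : (a <= N)%N -> forall i, (set_first (word_digits w) a i <= N)%N.
    by move=> aN [//|i]; exact: wN.
  case=> [Gz|[y Gy <-]]; rewrite /base /low; case: leqP => h.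
  - by rewrite subr0 addrC; exact: attractor_expansion.
  - have aN : (word_digits w 0 - j <= N)%N by exact: leq_trans (leq_subr _ _) _.
    have := attractor_expansion Gamma_attr k.+1 (firstN _ aN) Gz.
    rewrite expansion_set_first natrB; last by have := wN 0%N; lia.
    by congr (Gamma _); ring.
  - have := attractor_expansion Gamma_attr k.+1 (firstN _ h) Gy.
    rewrite expansion_set_first natrD mulrDr et.
    by congr (Gamma _); ring.
  - have := attractor_expansion Gamma_attr k.+1 wN Gy.
    by rewrite mulrDr et; congr (Gamma _); ring.
have copy_cov z : Gamma z -> exists w y, E y /\ z = beta ^+ k.+1 * y + base w.
  move=> Gz; have [x [y [xN Gy ->]]] := attractor_expansionP Gamma_attr k.+1 Gz.
  have [w ew] := expansion_word k xN.
  exists w; rewrite /base ew; case: ifP => _.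
    by exists y; split; [exact: inE|ring].
  by exists (y + t); split; [exact: inEt|rewrite mulrDr et; ring].
split.
- by have [y Gy] := Gne; exists y; left.
- apply: compactU => //; apply: continuous_compact => //.
  by apply: continuous_subspaceT => y; apply: cvgD; [exact: cvg_id|exact: cvg_cst].
exists #|{: T}|, (fun=> beta ^+ k.+1), (fun i => c (enum_val i)); split.
  move=> _; rewrite gtr0_norm // bk0 exprn_ilt1 //.
  - exact/ltW/beta_gt0/beta_bnd.
  - by have := beta_lt13 N_gt0 beta_bnd; have := beta_gt0 beta_bnd; lra.
rewrite eqEsubset; split => z.
  have cov b z' : Gamma z' -> exists p : T, exists2 y, E y &
      beta ^+ k.+1 * y + c p = z' + (if b then t else 0).
    move=> Gz; have [w [y [Ey ->]]] := copy_cov _ Gz.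
    by exists (b, w), y => //; rewrite /c /= addrA.
  have {}cov b z' : Gamma z' -> (\bigcup_(i in [set: 'I_#|{: T}|])
      (similitude (beta ^+ k.+1) (c (enum_val i)) @` E)) (z' + if b then t else 0).
    move=> /(cov b)[p [y Ey e]]; exists (enum_rank p) => //; exists y => //.
    by rewrite /similitude enum_rankK.
  case=> [Gz|[y Gy <-]]; last exact: (cov true).
  by rewrite -[z]addr0; exact: (cov false).
case=> i _ [y Ey <-]; rewrite /similitude /c addrA.
by case: ifP => _; [exact/inEt/copy_sub|rewrite addr0; exact/inE/copy_sub].
Qed.

End Converse.

Theorem corollary1p6 (R : realType) (N : nat) (beta t : R) (Gamma : set R)
    (hN : (0 < N)%N) (hbeta : 0 < beta < 1 / (2 * N%:R + 1)) (ht : 0 < t)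
    (hGamma : is_attractor N beta Gamma) :
  self_similar (Gamma `|` translate Gamma t) <->
  exists j k : nat,
    [/\ (1 <= j <= (N + 1) %/ 2)%N, (0 < k)%N &
        t = j%:R * (1 - beta) / N%:R * beta ^- k].
Proof.
split; first exact: translation_form.
by case=> j [[|k] [jN // _ ->]]; exact: self_similar_union.
Qed.
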